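(* For $\ell\in\mathbb{Z}^{+}\cup\{0\}$, \begin{align*} \sum_{n=0}^{\infty} \frac{(-1)^nq^{n^2+\ell n}}{(-q;q)_n} = \frac{1}{(-q;q)_{\infty}} \sum_{n=0}^{\infty} q^{n(n+1)/2} \sum_{m=0}^{n} \left[\begin{matrix} n+\ell-1\\ m+\ell-1\end{matrix}\right]_q \frac{q^{m^2+\ell m}}{(q;q)_m}. \end{align*}
   Context: Here $|q|<1$, $(a;q)_0=1$, $(a;q)_n=(1-a)(1-aq)\cdots(1-aq^{n-1})$, $(a;q)_\infty=\lim_{n\to\infty}(a;q)_n$, and the Gaussian polynomial is $\left[\begin{matrix} N\\ n\end{matrix}\right]_q=\frac{(q;q)_N}{(q;q)_n(q;q)_{N-n}}$ if $0\le n\le N$ and $0$ otherwise.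
   Formalization: For ℓ=0 the Gaussian polynomial with both entries −1 (the n=m=0 term) is taken to be 1 instead of 0; with the value 0 the identity fails, e.g. at q=0 the left side is 1 and the right side 0. For ℓ≥1 nothing changes. *)

(* Defs.v *)
From Stdlib Require Import Reals ZArith.
From Coquelicot Require Import Coquelicot.

Open Scope C_scope.

Fixpoint qpoch (a q : C) (n : nat) : C :=
  match n with
  | O => 1
  | S k => qpoch a q k * (1 - a * q ^ k)
  end.

Definition is_qpoch_inf (a q P : C) : Prop :=
  filterlim (qpoch a q) eventually (locally P).

Definition gauss (q : C) (N n : Z) : C :=
  if ((0 <=? n) && (n <=? N))%Z%bool then
    qpoch q q (Z.to_nat N) / (qpoch q q (Z.to_nat n) * qpoch q q (Z.to_nat (N - n)))
  else 0.

(* Extends [gauss] by [-1; -1] = 1, i.e. (q;q)_{-1} / ((q;q)_{-1} (q;q)_0) with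
   the common factor cancelled. This symbol is the n = m = 0 coefficient
   [n+l-1; m+l-1] for l = 0, and the value 1 is forced there: at q = 0 the
   left-hand series is 1 and the right-hand side is this coefficient. *)
Definition gauss_ext (q : C) (N n : Z) : C :=
  if ((N =? -1) && (n =? -1))%Z%bool then 1 else gauss q N n.

(* Main.v *)
(** Put [z = q^l]. By the q-Pascal rule,
    [sum_m [n; m] q^(m(m-1)) z^m (zq^m; q)_(n-m) = 1], which turns the inner sum
    on the right into [sum_i (-z)^i q^(i(i-1)/2) / (q; q)_(n-i)]: both satisfy
    [h_(n+1)(z) = 1 - z (1 - q^(n+1)) h_n(zq)] after multiplication by [(q; q)_n].
    The M-th partial sum on the right is thus the sum over [i + k <= M] of
    [(-z)^i q^(i^2) q^(k(k+1)/2 + ik) / (q; q)_k]. By the q-binomial theorem, the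
    M-th partial sum on the left times [(-q; q)_M] is the same sum with
    [1 / (q; q)_k] replaced by [[M-i; k]]. The two coefficients differ by
    [O(|q|^(M-i-k+1))], so the difference of the double sums tends to 0. This
    gives the convergence on the right as well, without rearranging any
    infinite double series. *)

Require Import Defs.
From Stdlib Require Import Reals ZArith Lra Lia.
From Coquelicot Require Import Coquelicot.
Open Scope C_scope.

(* The type of a [sum_n] is a structure sort that only unfolds to [C], which [ring]
   and [field] do not see through. *)
Ltac in_C := lazymatch goal with |- @eq _ ?a ?b =>
  refine (eq_trans (eq_sym (Cplus_0_l a)) (eq_trans _ (Cplus_0_l b))) end.
Ltac cring := in_C; ring.
Ltac cfield := in_C; field.

(** * Finite complex sums *)

Lemma Cmult_cancel_l (a b c : C) : a <> 0 -> a * b = a * c -> b = c.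
Proof.
intros Ha H. transitivity (/ a * (a * b)); [|rewrite H]; field; exact Ha.
Qed.

Lemma Cminus_mult (a b c : C) : a - b * c = a + - b * c.
Proof. ring. Qed.

Lemma Csum_Sn (u : nat -> C) (n : nat) : sum_n u (S n) = sum_n u n + u (S n).
Proof. exact (sum_Sn u n). Qed.

Lemma Csum_recl (u : nat -> C) (n : nat) :
  sum_n u (S n) = u 0%nat + sum_n (fun k => u (S k)) n.
Proof.
induction n as [|n IH].
- now rewrite Csum_Sn, !sum_O.
- rewrite Csum_Sn, IH, Csum_Sn. cring.
Qed.

Lemma Csum_plus (u v : nat -> C) (n : nat) :
  sum_n (fun k => u k + v k) n = sum_n u n + sum_n v n.
Proof. exact (sum_n_plus u v n). Qed.

Lemma Csum_mult_l (a : C) (u : nat -> C) (n : nat) :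
  sum_n (fun k => a * u k) n = a * sum_n u n.
Proof. exact (sum_n_mult_l a u n). Qed.

(** Raising [M] by one adds the antidiagonal [i + k = M + 1], that is, one term to each row [i <= M]
    and a new row of length one. *)
Lemma Csum_triangle (f : nat -> nat -> C) (M : nat) :
  sum_n (fun n => sum_n (fun i => f i (n - i)%nat) n) M =
  sum_n (fun i => sum_n (f i) (M - i)) M.
Proof.
induction M as [|M IH].
- now rewrite !sum_O.
- rewrite Csum_Sn, IH, !Csum_Sn, Nat.sub_diag, sum_O, Cplus_assoc, <- Csum_plus.
  f_equal. apply sum_n_ext_loc. intros i Hi.
  now rewrite Nat.sub_succ_l, Csum_Sn by exact Hi.
Qed.

(** * Shifted factorials, triangular exponents and Gaussian polynomials *)

Lemma qpoch_add (a q : C) (m k : nat) :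
  qpoch a q (m + k) = qpoch a q m * qpoch (a * q ^ m) q k.
Proof.
induction k as [|k IH]; simpl.
- rewrite Nat.add_0_r. cring.
- rewrite Nat.add_succ_r. simpl. rewrite IH, Cpow_add_r. cring.
Qed.

Lemma qpoch_recl (a q : C) (n : nat) :
  qpoch a q (S n) = (1 - a) * qpoch (a * q) q n.
Proof.
change (S n) with (1 + n)%nat. rewrite qpoch_add. simpl.
now rewrite !Cmult_1_r, Cmult_1_l.
Qed.

(* [tri n = n (n - 1) / 2]. *)
Fixpoint tri (n : nat) : nat :=
  match n with O => O | S k => (tri k + k)%nat end.

Lemma tri_add (n k : nat) : tri (n + k) = (tri n + tri k + n * k)%nat.
Proof. induction n as [|n IH]; simpl; [|rewrite IH]; lia. Qed.

Lemma sqr_tri (n : nat) : (n ^ 2 = 2 * tri n + n)%nat.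
Proof. induction n as [|n IH]; simpl in *; lia. Qed.

Lemma half_tri (n : nat) : (n * (n + 1) / 2 = tri n + n)%nat.
Proof.
symmetry. apply Nat.div_unique_exact; [discriminate|].
generalize (sqr_tri n). simpl. lia.
Qed.

(** Gaussian polynomials by the q-Pascal rule. Being free of division, they satisfy their polynomial
    identities for every [q], and they vanish for [k > n]. *)
Fixpoint gbin (q : C) (n k : nat) : C :=
  match n, k with
  | _, O => 1
  | O, S _ => 0
  | S n', S k' => gbin q n' k' + q ^ S k' * gbin q n' (S k')
  end.

Lemma gbin_gt (q : C) (n k : nat) : (n < k)%nat -> gbin q n k = 0.
Proof.
revert k; induction n as [|n IH]; intros [|k] Hk; try lia; simpl; [easy|].
rewrite !IH by lia. cring.
Qed.

Lemma gbin_0 (q : C) (n : nat) : gbin q n 0 = 1.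
Proof. now destruct n. Qed.

Lemma gbin_S (q : C) (n k : nat) :
  gbin q (S n) (S k) = gbin q n k + q ^ S k * gbin q n (S k).
Proof. easy. Qed.

Lemma gbin_qpoch (q : C) (k j : nat) :
  gbin q (k + j) k * (qpoch q q k * qpoch q q j) = qpoch q q (k + j).
Proof.
remember (k + j)%nat as n eqn:Hn. revert k j Hn.
induction n as [|n IH]; intros k j Hn.
- replace k with 0%nat by lia. replace j with 0%nat by lia. simpl. cring.
- destruct k as [|k]; [rewrite gbin_0; replace j with (S n) by lia; simpl; cring|].
  rewrite gbin_S. destruct j as [|j].
  + rewrite (gbin_gt q n (S k)) by lia.
    generalize (IH k 0%nat ltac:(lia)). simpl.
    replace n with k by lia. intros H. rewrite <- H at 2. cring.
  + assert (H1 := IH k (S j) ltac:(lia)). assert (H2 := IH (S k) j ltac:(lia)).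
    (* With [n + 1 = (k + 1) + (j + 1)], the last factor splits as [1 - q^(n+1) = (1 - q^(k+1)) +
       q^(k+1) (1 - q^(j+1))], which matches the two terms of the Pascal rule. *)
    replace (qpoch q q (S n)) with
      (qpoch q q n * (1 - q * q ^ k) + q * q ^ k * (qpoch q q n * (1 - q * q ^ j))).
    2:{ replace n with (S (k + j))%nat by lia. simpl. rewrite Cpow_add_r. cring. }
    rewrite <- H1 at 1. rewrite <- H2. simpl. cring.
Qed.

Lemma gbin_absorb (q : C) (n k : nat) :
  qpoch q q n <> 0 -> (k <= n)%nat ->
  (1 - q ^ S k) * gbin q (S n) (S k) = (1 - q ^ S n) * gbin q n k.
Proof.
intros Hq Hk. destruct (Nat.le_exists_sub k n Hk) as [j [-> _]].
rewrite (Nat.add_comm j k) in *. clear Hk.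
assert (H1 := gbin_qpoch q k j). assert (H2 := gbin_qpoch q (S k) j).
assert (Hkj : qpoch q q k * qpoch q q j <> 0).
{ intros H. rewrite H, Cmult_0_r in H1. now apply Hq. }
simpl Nat.add in H2. remember (gbin q (S (k + j)) (S k)) as g.
simpl in H2. rewrite <- H1 in H2.
apply (Cmult_cancel_l (qpoch q q k * qpoch q q j)); [exact Hkj|].
transitivity (g * (qpoch q q k * (1 - q * q ^ k) * qpoch q q j)); [simpl; cring|].
rewrite H2. simpl. cring.
Qed.

(** Peel off the factor [1 + x] and use induction at [x q]: comparing the coefficients of [x^(k+1)]
    leaves exactly the q-Pascal rule. *)
Lemma qbinomial (q x : C) (n : nat) :
  qpoch (- x) q n = sum_n (fun k => gbin q n k * q ^ tri k * x ^ k) n.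
Proof.
revert x; induction n as [|n IH]; intros x.
- rewrite sum_O. simpl. cring.
- rewrite qpoch_recl, Csum_recl.
  replace (- x * q) with (- (x * q)) by cring. rewrite IH.
  transitivity (1 + (sum_n (fun k => x * (gbin q n k * q ^ tri k * (x * q) ^ k)) n
     + sum_n (fun k => gbin q n (S k) * q ^ tri (S k) * (x * q) ^ S k) n)).
  + set (s := sum_n (fun k => _) n).
    assert (Hs : s = 1 + sum_n (fun k => gbin q n (S k) * q ^ tri (S k) * (x * q) ^ S k) n).
    { transitivity (sum_n (fun k => gbin q n k * q ^ tri k * (x * q) ^ k) (S n)).
      - rewrite Csum_Sn, (gbin_gt q n (S n)) by lia. unfold s. cring.
      - rewrite Csum_recl, gbin_0. simpl. cring. }
    rewrite Csum_mult_l. fold s.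
    transitivity (s + x * s); [cring|]. rewrite Hs at 1. cring.
  + rewrite <- Csum_plus, gbin_0. f_equal; [simpl; cring|].
    apply sum_n_ext. intros k. rewrite gbin_S. simpl tri.
    rewrite !Cpow_add_r, !Cpow_mult_l, !Cpow_S. cring.
Qed.

(** * Evaluation of the inner sum on the right *)

(** After the Pascal rule, each [[n; m]] occurs twice, with [(z q^m; q)_(n+1-m) = (1 - z q^m) (z
    q^(m+1); q)_(n-m)] and with [z q^m (z q^(m+1); q)_(n-m)]. These add up to
    [(z q^(m+1); q)_(n-m)], the factor needed for induction at [z q]. *)
Lemma gbin_sum_one (q z : C) (n : nat) :
  sum_n (fun m => gbin q n m * q ^ (2 * tri m) * z ^ m * qpoch (z * q ^ m) q (n - m)) n = RtoC 1.
Proof.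
revert z; induction n as [|n IH]; intros z.
- rewrite sum_O. simpl. cring.
- transitivity (sum_n (fun m => gbin q n m * q ^ (2 * tri m) * (z * q) ^ m *
      qpoch (z * q ^ m) q (S n - m)
      + z * q ^ m * (gbin q n m * q ^ (2 * tri m) * (z * q) ^ m *
      qpoch (z * q * q ^ m) q (n - m))) n).
  + rewrite Csum_plus.
    transitivity (sum_n (fun m => gbin q n m * q ^ (2 * tri m) * (z * q) ^ m *
      qpoch (z * q ^ m) q (S n - m)) (S n)
      + sum_n (fun m => z * q ^ m * (gbin q n m * q ^ (2 * tri m) * (z * q) ^ m *
      qpoch (z * q * q ^ m) q (n - m))) n).
    * rewrite !Csum_recl, !gbin_0, <- Cplus_assoc, <- Csum_plus.
      f_equal. apply sum_n_ext. intros m.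
      rewrite gbin_S. simpl Nat.sub. simpl tri.
      replace (z * q ^ S m) with (z * q * q ^ m) by (simpl; cring).
      replace (2 * (tri m + m))%nat with (2 * tri m + m + m)%nat by lia.
      rewrite !Cpow_add_r, !Cpow_mult_l, !Cpow_S. cring.
    * rewrite Csum_Sn, (gbin_gt q n (S n)) by lia. cring.
  + rewrite <- (IH (z * q)). apply sum_n_ext_loc. intros m Hm.
    rewrite Nat.sub_succ_l, qpoch_recl by exact Hm.
    replace (z * q ^ m * q) with (z * q * q ^ m) by cring. cring.
Qed.

Lemma inner_sum_scaled (q z : C) (n : nat) :
  (forall k, qpoch q q k <> 0) ->
  sum_n (fun m => gbin q n m * q ^ (m ^ 2) * z ^ m * qpoch (z * q ^ m) q (n - m)) n =
  sum_n (fun i => (- z) ^ i * q ^ tri i * (qpoch q q n / qpoch q q (n - i))) n.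
Proof.
intros Hq. revert z; induction n as [|n IH]; intros z.
- rewrite !sum_O. simpl. cfield. 
- transitivity (1 - z * (1 - q ^ S n) *
    sum_n (fun m => gbin q n m * q ^ (m ^ 2) * (z * q) ^ m * qpoch (z * q * q ^ m) q (n - m)) n).
  (* Expand the leading 1 by [gbin_sum_one] and compare termwise. Since
     [(m+1)^2 = 2 * tri (m+1) + (m+1)], the terms of index [m + 1] differ by a factor [1 - q^(m+1)],
     which [gbin_absorb] trades for [1 - q^(n+1)]. The terms of index 0 agree. *)
  + rewrite <- (gbin_sum_one q z (S n)) at 1. rewrite Cminus_mult.
    rewrite <- Csum_mult_l, !Csum_recl, <- Cplus_assoc, <- Csum_plus.
    f_equal. apply sum_n_ext_loc. intros m Hm.
    set (t := qpoch (z * q * q ^ m) q (n - m)).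
    replace (- (z * (1 - q ^ S n)) * (gbin q n m * q ^ (m ^ 2) * (z * q) ^ m * t))
      with (- z * ((1 - q ^ S n) * gbin q n m) * (q ^ (m ^ 2) * (z * q) ^ m * t)) by cring.
    unfold t; clear t.
    rewrite <- gbin_absorb by auto.
    replace (z * q * q ^ m) with (z * q ^ S m) by (simpl; cring).
    replace (S n - S m)%nat with (n - m)%nat by lia.
    rewrite !sqr_tri. simpl tri.
    replace (2 * (tri m + m) + S m)%nat with (2 * tri m + m + m + S m)%nat by lia.
    replace (2 * (tri m + m))%nat with (2 * tri m + m + m)%nat by lia.
    rewrite !Cpow_add_r, !Cpow_mult_l, !Cpow_S. cring.
  (* Here the recurrence is a shift of [i]: the factor [q^i] from [(- z q)^i] raises [tri i] to
     [tri (i+1)], and [1 - q^(n+1)] completes [(q; q)_(n+1)]. *)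
  + rewrite IH, Csum_recl, Cminus_mult, <- Csum_mult_l. f_equal.
    * rewrite Nat.sub_0_r. simpl tri. simpl Cpow. cfield. apply Hq.
    * apply sum_n_ext. intros i. simpl tri. simpl Nat.sub.
      replace (- (z * q)) with (- z * q) by cring.
      rewrite Cpow_add_r, !Cpow_mult_l, !Cpow_S. simpl qpoch.
      cfield. apply Hq.
Qed.

Lemma inner_sum (q z : C) (n : nat) :
  (forall k, qpoch q q k <> 0) ->
  sum_n (fun m => qpoch (z * q ^ m) q (n - m) / qpoch q q (n - m) *
                  (q ^ (m ^ 2) * z ^ m / qpoch q q m)) n =
  sum_n (fun i => (- z) ^ i * q ^ tri i / qpoch q q (n - i)) n.
Proof.
intros Hq. apply (Cmult_cancel_l (qpoch q q n)); [apply Hq|].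
rewrite <- !Csum_mult_l.
transitivity (sum_n (fun i => (- z) ^ i * q ^ tri i * (qpoch q q n / qpoch q q (n - i))) n).
- rewrite <- inner_sum_scaled by exact Hq. apply sum_n_ext_loc. intros m Hm.
  assert (H := gbin_qpoch q m (n - m)).
  replace (m + (n - m))%nat with n in H by lia. rewrite <- H. cfield. split; apply Hq.
- apply sum_n_ext. intros i. cfield. apply Hq.
Qed.

(** Cancelling [(q; q)_(m+l-1)] leaves [l] only inside [q^l], so that [inner_sum] applies with
    [z = q^l]. *)
Lemma gauss_ext_qpoch (q : C) (l n m : nat) :
  (forall k, qpoch q q k <> 0) -> (m <= n)%nat ->
  gauss_ext q (Z.of_nat n + Z.of_nat l - 1) (Z.of_nat m + Z.of_nat l - 1) =
  qpoch (q ^ l * q ^ m) q (n - m) / qpoch q q (n - m).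
Proof.
intros Hq Hm. unfold gauss_ext, gauss. rewrite <- Cpow_add_r.
destruct (l + m)%nat as [|p] eqn:Hp.
(* The lower index is -1. For [n = 0] the convention of [gauss_ext] agrees with the empty product;
   for [n > 0] the coefficient is 0, as is the factor [1 - q^0] on the right. *)
- replace l with 0%nat by lia. replace m with 0%nat by lia.
  destruct n as [|n].
  + simpl. cfield.
  + replace (Z.of_nat (S n) + Z.of_nat 0 - 1 =? -1)%Z with false
      by (symmetry; apply Z.eqb_neq; lia).
    simpl andb. rewrite Nat.sub_0_r, qpoch_recl.
    change (q ^ 0) with (1 : C). unfold Cdiv. cring.
- replace (Z.of_nat m + Z.of_nat l - 1)%Z with (Z.of_nat p) by lia.
  replace (Z.of_nat n + Z.of_nat l - 1)%Z with (Z.of_nat (p + (n - m))) by lia.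
  replace (Z.of_nat (p + (n - m)) =? -1)%Z with false
    by (symmetry; apply Z.eqb_neq; lia).
  replace (0 <=? Z.of_nat p)%Z with true by (symmetry; apply Z.leb_le; lia).
  replace (Z.of_nat p <=? Z.of_nat (p + (n - m)))%Z with true
    by (symmetry; apply Z.leb_le; lia).
  simpl andb. cbv iota.
  replace (Z.of_nat (p + (n - m)) - Z.of_nat p)%Z with (Z.of_nat (n - m)) by lia.
  rewrite !Nat2Z.id, qpoch_add. simpl Cpow. cfield. split; apply Hq.
Qed.

(** * Uniform bounds and the convergence of shifted factorials *)

Lemma Rpow_le_antimono (r : R) (m n : nat) :
  (0 <= r < 1)%R -> (m <= n)%nat -> (r ^ n <= r ^ m)%R.
Proof.
intros Hr Hmn. replace n with (m + (n - m))%nat by lia. rewrite pow_add.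
rewrite <- (Rmult_1_r (r ^ m)) at 2.
apply Rmult_le_compat_l; [apply pow_le; lra|].
rewrite <- (pow1 (n - m)). apply pow_incr. lra.
Qed.

Lemma geom_prod_bound (u : nat -> R) (c r : R) :
  (0 <= c)%R -> (0 <= r < 1)%R -> (u 0%nat <= 1)%R -> (forall n, 0 <= u n)%R ->
  (forall n, u (S n) <= u n * (1 + c * r ^ n))%R ->
  forall n, (u n <= exp (c / (1 - r)))%R.
Proof.
intros Hc Hr H0 Hpos HS.
(* Since [1 + x <= exp x], the exponent grows as the partial geometric sum; keeping [1 - r^n] makes
   the induction close. *)
assert (H : forall n, (u n <= exp (c * (1 - r ^ n) / (1 - r)))%R).
{ induction n as [|n IH].
  - simpl. replace (c * (1 - 1) / (1 - r))%R with 0%R by (field; lra).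
    now rewrite exp_0.
  - eapply Rle_trans; [apply HS|].
    replace (c * (1 - r ^ S n) / (1 - r))%R
      with (c * (1 - r ^ n) / (1 - r) + c * r ^ n)%R by (simpl; field; lra).
    rewrite exp_plus.
    assert (Hx : (0 <= c * r ^ n)%R)
      by (apply Rmult_le_pos; [exact Hc | apply pow_le; lra]).
    apply Rmult_le_compat; [apply Hpos | lra | exact IH |].
    apply exp_ineq1_le. }
intros n. eapply Rle_trans; [apply H|].
assert (Hm : (c * (1 - r ^ n) / (1 - r) <= c / (1 - r))%R).
{ apply Rmult_le_compat_r; [left; apply Rinv_0_lt_compat; lra|].
  assert (0 <= c * r ^ n)%R by (apply Rmult_le_pos; [exact Hc | apply pow_le; lra]).
  lra. }
destruct Hm as [Hm | ->]; [left; now apply exp_increasing | apply Rle_refl].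
Qed.

Lemma Csum_geom_bound (u : nat -> C) (c r : R) (n : nat) :
  (0 <= c)%R -> (0 <= r < 1)%R ->
  (forall k, (k <= n)%nat -> (Cmod (u k) <= c * r ^ k)%R) ->
  (Cmod (sum_n u n) <= c / (1 - r))%R.
Proof.
intros Hc Hr Hu.
assert (H : (Cmod (sum_n u n) <= c * (1 - r ^ S n) / (1 - r))%R).
{ induction n as [|n IH].
  - rewrite sum_O. eapply Rle_trans; [now apply Hu|]. right. simpl. field. lra.
  - rewrite Csum_Sn. eapply Rle_trans; [apply Cmod_triangle|].
    replace (c * (1 - r ^ S (S n)) / (1 - r))%R
      with (c * (1 - r ^ S n) / (1 - r) + c * r ^ S n)%R by (simpl; field; lra).
    apply Rplus_le_compat; [apply IH; intros k Hk|]; apply Hu; lia. }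
eapply Rle_trans; [exact H|].
apply Rmult_le_compat_r; [left; apply Rinv_0_lt_compat; lra|].
assert (0 <= c * r ^ S n)%R by (apply Rmult_le_pos; [exact Hc | apply pow_le; lra]).
lra.
Qed.

Lemma qpoch_factor_ge (a q : C) (n : nat) :
  (Cmod q < 1)%R -> (Cmod (1 - a * q ^ n) >= 1 - Cmod a * Cmod q ^ n)%R.
Proof.
intros Hq. rewrite <- Cmod_pow, <- Cmod_mult.
assert (H := Cmod_triangle (1 - a * q ^ n) (a * q ^ n)).
replace (1 - a * q ^ n + a * q ^ n) with (RtoC 1) in H by ring.
rewrite Cmod_1 in H. lra.
Qed.

Lemma qpoch_factor_le (a q : C) (n : nat) :
  (Cmod (1 - a * q ^ n) <= 1 + Cmod a * Cmod q ^ n)%R.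
Proof.
assert (H := Cmod_triangle 1 (- (a * q ^ n))).
now rewrite Cmod_1, Cmod_opp, Cmod_mult, Cmod_pow in H.
Qed.

(** Uniformity in [a] matters: the bounds are applied at [q], at [- q] and at [q^(n-k+1)] with
    varying [n] and [k]. *)
Lemma qpoch_bounded (q : C) :
  (Cmod q < 1)%R ->
  exists K : R, (0 < K)%R /\ forall a n, (Cmod a <= Cmod q)%R ->
    (/ K <= Cmod (qpoch a q n) <= K)%R.
Proof.
intros Hq. assert (Hq0 := Cmod_ge_0 q). set (r := Cmod q) in *.
(* This is [geom_prod_bound] with [c = r / (1 - r)], a value that serves both the factors
   [1 - a q^k] and their reciprocals. *)
exists (exp (r / (1 - r) / (1 - r))). split; [apply exp_pos|].
intros a n Ha. assert (Ha0 := Cmod_ge_0 a).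
assert (Hrn : forall k, (0 <= r ^ k <= 1)%R).
{ intros k. split; [apply pow_le; lra|].
  apply (Rpow_le_antimono r 0 k); [lra|lia]. }
assert (Hx : forall k, (0 <= Cmod a * r ^ k <= r)%R).
{ intros k. specialize (Hrn k). split; nra. }
assert (Hr1 : (0 <= r / (1 - r))%R) by (apply Rdiv_le_0_compat; lra).
assert (Hr2 : (r <= r / (1 - r))%R).
{ apply (Rmult_le_reg_r (1 - r)); [lra|]. field_simplify; nra. }
assert (Hge : forall k, (1 - r <= Cmod (1 - a * q ^ k))%R).
{ intros k. specialize (Hx k). assert (H := qpoch_factor_ge a q k Hq).
  fold r in H. lra. }
assert (Hpos : forall k, (0 < Cmod (qpoch a q k))%R).
{ induction k as [|k IH]; simpl.
  - rewrite Cmod_1. lra.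
  - rewrite Cmod_mult. apply Rmult_lt_0_compat; [exact IH|].
    specialize (Hge k). lra. }
split.
(* The lower bound is an upper bound for the reciprocal product. *)
- rewrite <- (Rinv_inv (Cmod (qpoch a q n))).
  apply Rinv_le_contravar; [apply Rinv_0_lt_compat, Hpos|].
  revert n. apply (geom_prod_bound (fun n => (/ Cmod (qpoch a q n))%R)); try lra.
  + simpl. rewrite Cmod_1. lra.
  + intros k. left. apply Rinv_0_lt_compat, Hpos.
  + intros k. simpl. rewrite Cmod_mult, Rinv_mult.
    apply Rmult_le_compat_l; [left; apply Rinv_0_lt_compat, Hpos|].
    specialize (Hge k). specialize (Hx k). specialize (Hrn k).
    assert (H := qpoch_factor_ge a q k Hq). fold r in H.
    apply (Rmult_le_reg_r (Cmod (1 - a * q ^ k))); [lra|].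
    rewrite Rinv_l by lra.
    (* [(1 + x / (1 - r)) (1 - x) >= 1] for [0 <= x <= r] *)
    set (x := (Cmod a * r ^ k)%R) in *.
    assert (Hxr : (x <= r * r ^ k)%R) by (unfold x; nra).
    apply Rle_trans with ((1 + x / (1 - r)) * (1 - x))%R.
    * apply (Rmult_le_reg_r (1 - r)); [lra|]. field_simplify; nra.
    * assert (Hd : (x / (1 - r) <= r / (1 - r) * r ^ k)%R).
      { unfold Rdiv. rewrite (Rmult_comm r), Rmult_assoc, Rmult_comm.
        apply Rmult_le_compat_l; [left; apply Rinv_0_lt_compat|]; lra. }
      assert (0 <= x / (1 - r))%R by (apply Rdiv_le_0_compat; lra).
      apply Rmult_le_compat; lra.
- revert n. apply (geom_prod_bound (fun n => Cmod (qpoch a q n))); try lra.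
  + simpl. rewrite Cmod_1. lra.
  + intros k. left. apply Hpos.
  + intros k. simpl. rewrite Cmod_mult.
    apply Rmult_le_compat_l; [left; apply Hpos|].
    eapply Rle_trans; [apply qpoch_factor_le|]. fold r.
    specialize (Hrn k). nra.
Qed.

Lemma qpoch_sub_one (a q : C) (K : R) (n : nat) :
  (Cmod q < 1)%R -> (forall k, (Cmod (qpoch a q k) <= K)%R) ->
  (Cmod (qpoch a q n - 1) <= K * Cmod a / (1 - Cmod q))%R.
Proof.
intros Hq HK. assert (Hq0 := Cmod_ge_0 q). assert (Ha0 := Cmod_ge_0 a).
assert (HK0 : (0 <= K)%R) by (eapply Rle_trans; [apply Cmod_ge_0 | apply (HK 0%nat)]).
destruct n as [|n].
- simpl. replace (1 - 1) with (RtoC 0) by ring. rewrite Cmod_0.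
  apply Rdiv_le_0_compat; [|lra]. now apply Rmult_le_pos.
(* Telescoping: consecutive shifted factorials differ by [- (a; q)_k a q^k], which is geometrically
   small. *)
- replace (qpoch a q (S n) - 1) with (sum_n (fun k => - (qpoch a q k * (a * q ^ k))) n).
  + apply Csum_geom_bound; [now apply Rmult_le_pos | lra|].
    intros k _. rewrite Cmod_opp, !Cmod_mult, Cmod_pow, <- Rmult_assoc.
    apply Rmult_le_compat_r; [apply pow_le; lra|].
    now apply Rmult_le_compat_r.
  + induction n as [|n IH].
    * rewrite sum_O. simpl. cring.
    * rewrite Csum_Sn, IH. simpl. cring.
Qed.

Lemma ex_qpoch_inf (a q : C) (K : R) :
  (Cmod q < 1)%R -> (forall k, (Cmod (qpoch a q k) <= K)%R) ->
  exists P, is_qpoch_inf a q P.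
Proof.
intros Hq HK. assert (Hq0 := Cmod_ge_0 q). assert (Ha0 := Cmod_ge_0 a).
(* The increments of [qpoch a q], started at [(a; q)_0 = 1], so that the partial sums of [d] are the
   shifted factorials themselves. *)
pose (d n := match n with O => RtoC 1 | S k => - (qpoch a q k * (a * q ^ k)) end).
assert (Hd : ex_series (K := C_AbsRing) (V := C_NormedModule) d).
{ apply ex_series_incr_1.
  apply (ex_series_le (V := C_CompleteNormedModule) _ (fun k => K * Cmod a * Cmod q ^ k)%R).
  - intros k. change (Cmod (d (S k)) <= K * Cmod a * Cmod q ^ k)%R. simpl.
    rewrite Cmod_opp, !Cmod_mult, Cmod_pow, <- Rmult_assoc.
    apply Rmult_le_compat_r; [apply pow_le; lra|].
    now apply Rmult_le_compat_r.
  - apply (ex_series_scal (V := R_NormedModule) (K * Cmod a)%R (fun k => Cmod q ^ k)%R).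
    apply ex_series_geom.
    rewrite Rabs_pos_eq; lra. }
destruct Hd as [P HP]. exists P.
apply (filterlim_ext (sum_n d)); [|exact HP].
induction x as [|n IH].
- now rewrite sum_O.
- rewrite Csum_Sn, IH. simpl. ring.
Qed.

(** The difference is [((q^(n-k+1); q)_k - 1) / (q; q)_k], and [qpoch_sub_one] makes the numerator
    of order [q^(n-k+1)]. *)
Lemma gbin_sub_inv (q : C) (K : R) (n k : nat) :
  (Cmod q < 1)%R -> (0 < K)%R ->
  (forall a j, (Cmod a <= Cmod q)%R -> (/ K <= Cmod (qpoch a q j) <= K)%R) ->
  (k <= n)%nat ->
  (Cmod (gbin q n k - / qpoch q q k) <= K * K / (1 - Cmod q) * Cmod q ^ S (n - k))%R.
Proof.
intros Hq HK0 HK Hk. assert (Hq0 := Cmod_ge_0 q).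
assert (Hnz : forall j, qpoch q q j <> 0).
{ intros j. apply Cmod_gt_0.
  apply Rlt_le_trans with (/ K)%R; [now apply Rinv_0_lt_compat | apply HK; lra]. }
replace (gbin q n k - / qpoch q q k)
  with (/ qpoch q q k * (qpoch (q * q ^ (n - k)) q k - 1)).
- rewrite Cmod_mult, Cmod_inv by apply Hnz.
  replace (K * K / (1 - Cmod q) * Cmod q ^ S (n - k))%R
    with (K * (K * Cmod (q * q ^ (n - k)) / (1 - Cmod q)))%R
    by (rewrite Cmod_mult, Cmod_pow; simpl; field; lra).
  apply Rmult_le_compat; try apply Cmod_ge_0.
  + left. apply Rinv_0_lt_compat, Cmod_gt_0, Hnz.
  + rewrite <- (Rinv_inv K). apply Rinv_le_contravar; [now apply Rinv_0_lt_compat|].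
    apply HK; lra.
  + apply qpoch_sub_one; [exact Hq|]. intros j. apply HK.
    rewrite <- Cpow_S, Cmod_pow. rewrite <- (pow_1 (Cmod q)) at 2.
    apply Rpow_le_antimono; [lra|lia].
- assert (H := gbin_qpoch q k (n - k)). assert (H' := qpoch_add q q (n - k) k).
  rewrite (Nat.add_comm (n - k) k), <- H in H'.
  replace (k + (n - k))%nat with n in H' by lia.
  apply (Cmult_cancel_l (qpoch q q (n - k) * qpoch q q k));
    [apply Cmult_neq_0; apply Hnz|].
  transitivity (qpoch q q (n - k) * qpoch (q * q ^ (n - k)) q k - qpoch q q (n - k));
    [field; apply Hnz|].
  rewrite <- H'. field. apply Hnz.
Qed.

Lemma le_S_tri (n : nat) : (n <= S (tri n))%nat.
Proof. destruct n as [|[|n]]; simpl; lia. Qed.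

(** * Limits of complex sequences *)

Lemma filterlim_Cmult (f g : nat -> C) (a b : C) :
  filterlim f eventually (locally a) -> filterlim g eventually (locally b) ->
  filterlim (fun n => f n * g n) eventually (locally (a * b)).
Proof.
intros Hf Hg.
(* [filterlim_scal] takes its scalar in the absolute-value topology of [C]; [locally_C] identifies
   those neighbourhoods with the product ones. *)
apply (filterlim_comp_2 (G := locally (T := AbsRing_UniformSpace C_AbsRing) a)
  (H := locally b) f g Cmult).
- intros U HU. apply Hf, locally_C, HU.
- exact Hg.
- exact (filterlim_scal (V := C_NormedModule) a b).
Qed.

Lemma filterlim_zero_of_geom (f : nat -> C) (c r : R) :
  (0 <= r < 1)%R -> (forall n, (Cmod (f n) <= c * r ^ pred n)%R) ->
  filterlim f eventually (locally (RtoC 0)).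
Proof.
intros Hr Hf. apply (filterlim_norm_zero (V := C_NormedModule)).
apply (is_lim_seq_le_le (fun _ => 0%R) _ (fun n => c * r ^ pred n)%R 0).
- intros n. split; [apply Cmod_ge_0 | apply Hf].
- apply is_lim_seq_const.
- apply is_lim_seq_incr_1. simpl.
  replace (Finite 0) with (Rbar_mult c 0) by (simpl; now rewrite Rmult_0_r).
  apply is_lim_seq_scal_l, is_lim_seq_geom. rewrite Rabs_pos_eq; lra.
Qed.

Lemma limit_neq_0 (f : nat -> C) (P : C) (e : R) :
  (0 < e)%R -> (forall n, (e <= Cmod (f n))%R) ->
  filterlim f eventually (locally P) -> P <> 0.
Proof.
intros He Hf HP. apply Cmod_gt_0. apply Rlt_le_trans with e; [exact He|].
apply (is_lim_seq_le (fun _ => e) (fun n => Cmod (f n)) e (Cmod P) Hf).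
- apply is_lim_seq_const.
- apply (filterlim_comp _ _ _ f Cmod _ _ _ HP).
  apply (filterlim_norm (V := C_NormedModule)).
Qed.

(** * Partial sums of both sides as double sums *)

(** With [n = i + k], the exponents obey [tri n + n + tri i = i^2 + tri k + (i+1) k]. The term of
    index [n] is thus an antidiagonal of a double sum, ready for [Csum_triangle]. *)
Lemma rhs_term (q : C) (l n : nat) :
  (forall k, qpoch q q k <> 0) ->
  q ^ (n * (n + 1) / 2) *
    sum_n (fun m : nat =>
      gauss_ext q (Z.of_nat n + Z.of_nat l - 1) (Z.of_nat m + Z.of_nat l - 1) *
      (q ^ (m ^ 2 + l * m) / qpoch q q m)) n =
  sum_n (fun i => (- q ^ l) ^ i * q ^ (i ^ 2) *
    (q ^ tri (n - i) * (q * q ^ i) ^ (n - i) * / qpoch q q (n - i))) n.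
Proof.
intros Hq.
transitivity (q ^ (tri n + n) *
  sum_n (fun i => (- q ^ l) ^ i * q ^ tri i / qpoch q q (n - i)) n).
- rewrite half_tri, <- inner_sum by exact Hq. f_equal.
  apply sum_n_ext_loc. intros m Hm.
  now rewrite gauss_ext_qpoch, Cpow_add_r, Cpow_mult_r by assumption.
- rewrite <- Csum_mult_l. apply sum_n_ext_loc. intros i Hi.
  remember (n - i)%nat as k eqn:Hk. replace n with (i + k)%nat by lia.
  rewrite <- Cpow_S, <- Cpow_mult_r, tri_add.
  replace (tri i + tri k + i * k + (i + k))%nat
    with (i + tri i + (tri k + S i * k))%nat by lia.
  rewrite sqr_tri. replace (2 * tri i + i)%nat with (i + tri i + tri i)%nat by lia.
  rewrite !Cpow_add_r. cfield. apply Hq.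
Qed.

(** The quotient [(-q; q)_M / (-q; q)_i] is [(-q^(i+1); q)_(M-i)], which [qbinomial] expands at
    [x = q^(i+1)]. *)
Lemma lhs_partial_sum (q : C) (l M : nat) :
  (forall k, qpoch (- q) q k <> 0) ->
  sum_n (fun n => (- (1)) ^ n * q ^ (n ^ 2 + l * n) / qpoch (- q) q n) M *
    qpoch (- q) q M =
  sum_n (fun i => sum_n (fun k => (- q ^ l) ^ i * q ^ (i ^ 2) *
    (q ^ tri k * (q * q ^ i) ^ k * gbin q (M - i) k)) (M - i)) M.
Proof.
intros Hq. rewrite Cmult_comm, <- Csum_mult_l. apply sum_n_ext_loc. intros i Hi.
replace (- q ^ l) with (- (1) * q ^ l) by ring.
rewrite Csum_mult_l, Cpow_mult_l, Cpow_add_r, Cpow_mult_r.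
transitivity ((- (1)) ^ i * (q ^ l) ^ i * q ^ (i ^ 2) * qpoch (- (q * q ^ i)) q (M - i)).
- replace M with (i + (M - i))%nat at 1 by lia.
  rewrite qpoch_add. replace (- q * q ^ i) with (- (q * q ^ i)) by ring.
  cfield. apply Hq.
- f_equal. rewrite qbinomial. apply sum_n_ext. intros k. cring.
Qed.

(** One factor [1 / (1 - |q|)] comes from [gbin_sub_inv], the other two from geometric sums over [k]
    and [i]. *)
Lemma partial_sums_diff (q : C) (l : nat) (K : R) :
  (Cmod q < 1)%R -> (0 < K)%R ->
  (forall a j, (Cmod a <= Cmod q)%R -> (/ K <= Cmod (qpoch a q j) <= K)%R) ->
  forall M,
  (Cmod (sum_n (fun i => sum_n (fun k => ((- q ^ l) ^ i * q ^ (i ^ 2) *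
    (q ^ tri k * (q * q ^ i) ^ k * (gbin q (M - i) k - / qpoch q q k)))%C) (M - i)) M) <=
  K * K / (1 - Cmod q) / (1 - Cmod q) / (1 - Cmod q) * Cmod q ^ pred M)%R.
Proof.
intros Hq HK0 HK M. assert (Hq0 := Cmod_ge_0 q). set (r := Cmod q) in *.
set (c := (K * K / (1 - r))%R).
assert (Hc : (0 <= c)%R) by (apply Rdiv_le_0_compat; nra).
assert (Hrn : forall n, (0 <= r ^ n)%R) by (intros n; apply pow_le; lra).
replace (c / (1 - r) / (1 - r) * r ^ pred M)%R
  with (c * r ^ pred M / (1 - r) / (1 - r))%R by (field; lra).
apply Csum_geom_bound; [|lra|].
{ apply Rdiv_le_0_compat; [now apply Rmult_le_pos | lra]. }
intros i Hi.
replace (c * r ^ pred M / (1 - r) * r ^ i)%R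
  with (c * r ^ pred M * r ^ i / (1 - r))%R by (field; lra).
apply Csum_geom_bound; [now apply Rmult_le_pos; [apply Rmult_le_pos|] | lra |].
intros k Hk.
rewrite <- Cpow_S, <- (Cpow_mult_r q (S i)), !Cmod_mult, !Cmod_pow, Cmod_opp, Cmod_pow.
fold r.
assert (Hg := gbin_sub_inv q K (M - i) k Hq HK0 HK Hk). fold r c in Hg.
apply Rle_trans with (1 * r ^ (i ^ 2) * (r ^ tri k * r ^ (S i * k) * (c * r ^ S (M - i - k))))%R.
- apply Rmult_le_compat.
  + apply Rmult_le_pos; [now apply pow_le | apply Hrn].
  + repeat apply Rmult_le_pos; try apply Hrn. apply Cmod_ge_0.
  + apply Rmult_le_compat_r; [apply Hrn|].
    rewrite <- pow_mult. apply (Rpow_le_antimono r 0); [lra|lia].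
  + apply Rmult_le_compat_l; [|exact Hg]. now apply Rmult_le_pos.
- apply Rle_trans with (c * r ^ (i ^ 2 + tri k + S i * k + S (M - i - k)))%R.
  + right. rewrite !pow_add. ring.
  + rewrite !Rmult_assoc, <- !pow_add. apply Rmult_le_compat_l; [exact Hc|].
    (* The exponent must reach [pred M + i + k], to leave [r^i r^k] for the two sums. It equals
       [M + 1 + 2 * tri i + tri k + i k]; [le_S_tri] for [i] and for [k] loses one each, hence
       [pred M]. *)
    apply Rpow_le_antimono; [lra|]. rewrite sqr_tri.
    assert (H1 := le_S_tri i). assert (H2 := le_S_tri k). simpl. lia.
Qed.

Theorem theorem4p5 (l : nat) (q : C) (hq : (Cmod q < 1)%R) :
  exists A B P : C,
    is_series (fun n : nat =>
      (- (1)) ^ n * q ^ (n ^ 2 + l * n) / qpoch (- q) q n) A /\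
    is_series (fun n : nat =>
      q ^ (n * (n + 1) / 2) *
      sum_n (fun m : nat =>
        gauss_ext q (Z.of_nat n + Z.of_nat l - 1) (Z.of_nat m + Z.of_nat l - 1) *
        (q ^ (m ^ 2 + l * m) / qpoch q q m)) n) B /\
    is_qpoch_inf (- q) q P /\
    P <> 0 /\
    A = 1 / P * B.
Proof.
assert (Hq0 := Cmod_ge_0 q).
destruct (qpoch_bounded q hq) as [K [HK0 HK]].
assert (HiK : (0 < / K)%R) by now apply Rinv_0_lt_compat.
assert (Hmq : (Cmod (- q) <= Cmod q)%R) by (rewrite Cmod_opp; apply Rle_refl).
assert (Hnz : forall a n, (Cmod a <= Cmod q)%R -> qpoch a q n <> 0).
{ intros a n Ha. apply Cmod_gt_0. apply Rlt_le_trans with (1 := HiK). now apply HK. }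
set (a := fun n : nat => (- (1)) ^ n * q ^ (n ^ 2 + l * n) / qpoch (- q) q n).
assert (HA : ex_series (K := C_AbsRing) (V := C_NormedModule) a).
{ apply (ex_series_le (V := C_CompleteNormedModule) _ (fun n => K * Cmod q ^ n)%R).
  - intros n. change (Cmod (a n) <= K * Cmod q ^ n)%R. unfold a.
    rewrite Cmod_div by now apply Hnz.
    rewrite Cmod_mult, !Cmod_pow, Cmod_m1, pow1, Rmult_1_l.
    unfold Rdiv. rewrite Rmult_comm. apply Rmult_le_compat.
    + left. apply Rinv_0_lt_compat, Cmod_gt_0. now apply Hnz.
    + now apply pow_le.
    + rewrite <- (Rinv_inv K). apply Rinv_le_contravar; [exact HiK|]. now apply HK.
    + apply Rpow_le_antimono; [lra|]. simpl. nia.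
  - apply (ex_series_scal (V := R_NormedModule) K (fun n => Cmod q ^ n)%R).
    apply ex_series_geom. rewrite Rabs_pos_eq; lra. }
destruct HA as [A HA].
destruct (ex_qpoch_inf (- q) q K hq) as [P HP].
{ intros k. now apply HK. }
assert (HP0 : P <> 0).
{ apply (limit_neq_0 (qpoch (- q) q) P (/ K)); [exact HiK| |exact HP].
  intros n. now apply HK. }
(* The right-hand series is shown to converge to [A * P] directly, so its convergence and its value
   come together. *)
exists A, (A * P), P. split; [exact HA|]. split; [|split; [exact HP|split; [exact HP0|]]].
2: { cfield. exact HP0. }
set (D := fun M => sum_n (fun i => sum_n (fun k => (- q ^ l) ^ i * q ^ (i ^ 2) *
    (q ^ tri k * (q * q ^ i) ^ k * (gbin q (M - i) k - / qpoch q q k))) (M - i)) M).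
assert (HD : filterlim (fun M => - (1) * D M) eventually (locally (- (1) * 0))).
{ apply filterlim_Cmult; [apply filterlim_const|].
  apply (filterlim_zero_of_geom _
    (K * K / (1 - Cmod q) / (1 - Cmod q) / (1 - Cmod q)) (Cmod q)); [lra|].
  exact (partial_sums_diff q l K hq HK0 HK). }
(* For each [M], the right partial sum is exactly the left one times [(-q; q)_M], minus [D M]; the
   limit is put in the same shape. *)
replace (A * P) with (A * P + - (1) * 0) by ring.
apply (filterlim_ext (fun M => sum_n a M * qpoch (- q) q M + - (1) * D M)).
- intros M. unfold a. rewrite lhs_partial_sum by (intros k; now apply Hnz).
  refine (eq_trans _ (eq_sym (sum_n_ext _ _ M
    (fun n => rhs_term q l n (fun k => Hnz q k (Rle_refl _)))))).
  rewrite (Csum_triangle (fun i k => (- q ^ l) ^ i * q ^ (i ^ 2) *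
    (q ^ tri k * (q * q ^ i) ^ k * / qpoch q q k))).
  unfold D. rewrite <- Csum_mult_l, <- Csum_plus. apply sum_n_ext. intros i.
  rewrite <- Csum_mult_l, <- Csum_plus. apply sum_n_ext. intros k. cring.
- apply (filterlim_comp_2 (G := locally (A * P)) (H := locally (- (1) * 0)) _ _ Cplus).
  + now apply filterlim_Cmult.
  + exact HD.
  + apply (filterlim_plus (V := C_NormedModule)).
Qed.
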